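(* Let $f:\mathbb{R}^n\to\mathbb{R}$ be twice continuously differentiable and convex with $\gamma$-Lipschitz continuous Hessian ($\gamma>0$), and let $x_*$ be a minimizer of $f$. Let $\{x_t\}_{t\ge1}$ be generated by Algorithm AINCR, and assume that \[ \frac{\mu_t}{2}I\preceq H_t-\nabla^2 f(w_t)\preceq\mu_tI\qquad\forall t\ge0, \] where $0\le\mu_t\le\mu_u$ for some $\mu_u\ge0$. (a) If $f$ is strongly convex with parameter $\lambda>0$ (the value of $\lambda$ used in the algorithm) and the parameters are set to \[ \alpha_t=\hat\alpha=\min\left(\frac89,\ \left[\frac{\lambda}{18\sqrt3\,\mu_u}\right]^{1/2},\ \frac14\left[\frac{\lambda}{\gamma\bar R}\right]^{1/3}\right)\ (t\ge1),\qquad \bar\mu_t=\frac{\lambda}{4}\ \ \forall t\ge0,\qquad \beta=\frac{3\lambda}{2\bar R},\qquad \eta=4\gamma, \] where $\bar R>0$ is an upper bound for all $R_t$, $t\ge1$ (with $R_t$ an upper bound on $\|\bar x_t-y_t\|$, $\bar x_t$ as defined in the context), then for any $t\ge1$, \[ f(x_t)-f(x_* )\le2(1-\hat\alpha)^{t-1}[f(x_0)-f(x_* )]\left[\frac{2\mu_u\lambda^{-1}+1}{4}+\frac{4\gamma\lambda^{-1}+3\bar R^{-1}}{12}\|x_0-x_*\|\right]. \] (b) If $f$ is convex ($\lambda=0$ in the algorithm) and the parameters are set to \[ \alpha_t=\frac{3}{t+3},\qquad \bar\mu_t=2\mu_u(t+2)\ \ \forall t\ge0,\qquad \beta=96\gamma,\qquad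 \eta=4\gamma, \] then for any $t\ge1$, \[ f(x_t)-f(x_* )\le\frac{98\gamma\|x_0-x_*\|^3}{t(t+1)(t+2)}+\frac{12\mu_u\|x_0-x_*\|^2}{t(t+2)}. \]
   Context: $\|\cdot\|$ is the Euclidean norm for vectors and the spectral norm for matrices; $\preceq$ is the Loewner order. The Hessian of $f$ is $\gamma$-Lipschitz if $\|\nabla^2 f(x)-\nabla^2 f(x')\|\le\gamma\|x-x'\|$ for all $x,x'$. The function $f$ is strongly convex with parameter $\lambda\ge0$ if $f(\alpha x+(1-\alpha)x')\le\alpha f(x)+(1-\alpha)f(x')-\frac{\alpha(1-\alpha)\lambda}{2}\|x-x'\|^2$ for all $x,x'$, $\alpha\in[0,1]$. In a minimum, a term with zero denominator is read as $+\infty$. Algorithm AINCR (accelerated inexact Newton method with cubic regularization). Input: $x_0\in\mathbb{R}^n$, $\eta,\beta>0$, $\alpha_0=1$, $\alpha_t\in(0,1)$ for $t\ge1$, a nonnegative nondecreasing sequence $\{\bar\mu_t\}_{t\ge0}$, and a (strong) convexity parameter $\lambda\ge0$ of $f$. Put $A_0=1$, $A_t=\prod_{i=1}^t(1-\alpha_i)$ for $t\ge1$. For $t\ge0$, $H_t$ is a symmetric matrix approximating $\nabla^2 f(w_t)$, and for $c>0$, \[ \tilde f_c(x;w_t)=f(w_t)+\langle\nabla f(w_t),x-w_t\rangle+\tfrac12\langle H_t(x-w_t),x-w_t\rangle+\tfrac{c}{6}\|x-w_t\|^3 . \] Set $w_0=x_0$, $x_1=\arg\min_x\tilde f_\gamma(x;x_0)$,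 $\phi_1(x)=f(x_1)+\frac{\bar\mu_0}{2}\|x-x_0\|^2+\frac{\beta}{6}\|x-x_0\|^3$, and $y_1=\arg\min_x\phi_1(x)$. For $t=1,2,\dots$: \[ w_t=(1-\alpha_t)x_t+\alpha_ty_t,\qquad x_{t+1}=\arg\min_x\tilde f_\eta(x;w_t), \] \[ \phi_{t+1}(x)=\phi_t(x)+\frac{\bar\mu_t-\bar\mu_{t-1}}{2}\|x-x_0\|^2+\frac{\alpha_t}{A_t}\Big[f(x_{t+1})+\langle\nabla f(x_{t+1}),x-x_{t+1}\rangle+\frac{\lambda}{2}\|x-x_{t+1}\|^2\Big],\qquad y_{t+1}=\arg\min_x\phi_{t+1}(x). \] For $t\ge1$ put $\bar\lambda_t=\frac{\lambda}{2}\left(\frac1{A_{t-1}}-1\right)$ and \[ \bar x_t=\arg\min_{x\in\mathbb{R}^n}\left\{\frac{\bar\mu_{t-1}+\bar\lambda_t}{2}\|x-y_t\|^2+\frac{\beta}{12}\|x-y_t\|^3+\frac{\alpha_t}{A_t}\langle\nabla f(x_{t+1}),x-y_t\rangle\right\}; \] $R_t$ denotes a number with $\|\bar x_t-y_t\|\le R_t$. *)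

(* Defs.v *)
(* Vectors of R^n are columns of type 'cV[R]_n. *)
From HB Require Import structures.
From mathcomp Require Import all_boot all_order all_algebra.
From mathcomp Require Import all_classical all_reals all_analysis.

Set Implicit Arguments.
Unset Strict Implicit.
Unset Printing Implicit Defensive.

Import Order.TTheory GRing.Theory Num.Theory.
Import numFieldNormedType.Exports.

Local Open Scope classical_set_scope.
Local Open Scope ring_scope.

(* The library norm `|_| on matrices is the max norm, whence a separate
   Euclidean and spectral norm. The topologies, hence differentiability and
   continuity, are the same. *)
Definition dotv (R : realType) (n : nat) (u v : 'cV[R]_n) : R :=
  \sum_(i < n) u i 0 * v i 0.

Definition enorm (R : realType) (n : nat) (u : 'cV[R]_n) : R :=
  Num.sqrt (dotv u u).

Definition specnorm (R : realType) (n : nat) (A : 'M[R]_n) : R :=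
  sup [set enorm (A *m v) | v in [set v : 'cV[R]_n | enorm v <= 1]].

(* Loewner order: B - A is positive semidefinite. Symmetry is not part of the
   definition; the matrices it is applied to are symmetric. *)
Definition loewner_le (R : realType) (n : nat) (A B : 'M[R]_n) : Prop :=
  forall v : 'cV[R]_n, 0 <= dotv ((B - A) *m v) v.

Definition grad (R : realType) (n : nat) (f : 'cV[R]_n -> R) (x : 'cV[R]_n) :
    'cV[R]_n :=
  \col_i 'D_(delta_mx i 0) f x.

Definition hess (R : realType) (n : nat) (f : 'cV[R]_n -> R) (x : 'cV[R]_n) :
    'M[R]_n :=
  \matrix_(i, j) 'D_(delta_mx j 0) (fun z => grad f z i 0) x.

Definition twice_cont_diff (R : realType) (n : nat) (f : 'cV[R]_n -> R) :
    Prop :=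
  [/\ forall x, differentiable f x,
      forall x, differentiable (grad f) x &
      continuous (hess f)].

Definition hess_lipschitz (R : realType) (n : nat) (gamma : R)
    (f : 'cV[R]_n -> R) : Prop :=
  forall x x' : 'cV[R]_n,
    specnorm (hess f x - hess f x') <= gamma * enorm (x - x').

Definition strongly_convex (R : realType) (n : nat) (lambda : R)
    (f : 'cV[R]_n -> R) : Prop :=
  forall (x x' : 'cV[R]_n) (a : R), 0 <= a -> a <= 1 ->
    f (a *: x + (1 - a) *: x')
      <= a * f x + (1 - a) * f x'
         - a * (1 - a) * lambda / 2 * enorm (x - x') ^+ 2.

(* x is a global minimizer of g. The subproblems of the algorithm are strictly
   convex when the H_t are positive semidefinite, so there
   "x is a minimizer" and "x = argmin" agree. *)
Definition is_argmin (R : realType) (n : nat) (g : 'cV[R]_n -> R)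
    (x : 'cV[R]_n) : Prop :=
  forall y, g x <= g y.

Definition cubic_model (R : realType) (n : nat) (f : 'cV[R]_n -> R)
    (H : 'M[R]_n) (c : R) (w x : 'cV[R]_n) : R :=
  f w + dotv (grad f w) (x - w) + 2^-1 * dotv (H *m (x - w)) (x - w)
  + c / 6 * enorm (x - w) ^+ 3.

Definition Aseq (R : realType) (alpha : nat -> R) (t : nat) : R :=
  \prod_(1 <= i < t.+1) (1 - alpha i).

(* A run of the accelerated inexact Newton method with cubic regularization.
   The values y 0 and phi 0 are irrelevant. *)
Record AINCR (R : realType) (n : nat) (f : 'cV[R]_n -> R)
    (gamma eta beta lambda : R) (alpha mubar : nat -> R) (x0 : 'cV[R]_n)
    (H : nat -> 'M[R]_n) (w x y : nat -> 'cV[R]_n)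
    (phi : nat -> 'cV[R]_n -> R) : Prop := {
  aincr_eta_gt0 : 0 < eta;
  aincr_beta_gt0 : 0 < beta;
  aincr_alpha0 : alpha 0%N = 1;
  aincr_alpha_itv : forall t, (1 <= t)%N -> 0 < alpha t < 1;
  aincr_mubar_ge0 : forall t, 0 <= mubar t;
  aincr_mubar_nondecr : forall t, mubar t <= mubar t.+1;
  aincr_lambda_ge0 : 0 <= lambda;
  aincr_lambda_param : strongly_convex lambda f;
  aincr_H_sym : forall t, (H t)^T = H t;
  aincr_x0 : x 0%N = x0;
  aincr_w0 : w 0%N = x0;
  aincr_x1 : is_argmin (cubic_model f (H 0%N) gamma x0) (x 1%N);
  aincr_phi1 : forall z,
    phi 1%N z = f (x 1%N) + mubar 0%N / 2 * enorm (z - x0) ^+ 2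
                + beta / 6 * enorm (z - x0) ^+ 3;
  aincr_y : forall t, (1 <= t)%N -> is_argmin (phi t) (y t);
  aincr_w : forall t, (1 <= t)%N ->
    w t = (1 - alpha t) *: x t + alpha t *: y t;
  aincr_xS : forall t, (1 <= t)%N ->
    is_argmin (cubic_model f (H t) eta (w t)) (x t.+1);
  aincr_phiS : forall t, (1 <= t)%N -> forall z,
    phi t.+1 z =
      phi t z + (mubar t - mubar t.-1) / 2 * enorm (z - x0) ^+ 2
      + alpha t / Aseq alpha t *
        (f (x t.+1) + dotv (grad f (x t.+1)) (z - x t.+1)
         + lambda / 2 * enorm (z - x t.+1) ^+ 2)
}.

Definition lambdabar (R : realType) (lambda : R) (alpha : nat -> R) (t : nat) :
    R :=
  lambda / 2 * ((Aseq alpha t.-1)^-1 - 1).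

Definition xbar_obj (R : realType) (n : nat) (f : 'cV[R]_n -> R)
    (beta lambda : R) (alpha mubar : nat -> R) (x y : nat -> 'cV[R]_n)
    (t : nat) (z : 'cV[R]_n) : R :=
  (mubar t.-1 + lambdabar lambda alpha t) / 2 * enorm (z - y t) ^+ 2
  + beta / 12 * enorm (z - y t) ^+ 3
  + alpha t / Aseq alpha t * dotv (grad f (x t.+1)) (z - y t).

(* (a / b)^(1/k), read as +oo when b = 0. *)
Definition root_ratio (R : realType) (k : nat) (a b : R) : \bar R :=
  if b == 0 then +oo%E else ((a / b) `^ (k%:R^-1))%:E.

(* The minimum is at most 8/9, so fine does not lose information. *)
Definition alpha_hat (R : realType) (lambda gamma mu_u Rbar : R) : R :=
  fine (mine (8 / 9)%:E
         (mine (root_ratio 2 lambda (18 * Num.sqrt 3 * mu_u))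
               ((4^-1)%:E * root_ratio 3 lambda (gamma * Rbar))%E)).

(* Main.v *)
Require Import Defs.
From HB Require Import structures.
From mathcomp Require Import all_boot all_order all_algebra.
From mathcomp Require Import all_classical all_reals all_analysis.
From mathcomp Require Import ring lra.
Import Order.TTheory GRing.Theory Num.Theory.
Import numFieldNormedType.Exports.
Local Open Scope classical_set_scope.
Local Open Scope ring_scope.

(** The proof follows the estimate-sequence scheme of accelerated methods: the
    functions [phi t] are squeezed between the iterates and [f], as
    [f (x t) / A (t - 1) <= min phi t] ([phi_lb]) and
    [phi t <= f / A (t - 1) + (phi 1 - f)] ([phi_ub]). At a minimizer [xs] of
    [f] the two bounds give
    [f (x t) - f xs <= A (t - 1) * (phi 1 xs - f xs)], where [phi 1 xs - f xs] is
    controlled by the model of the first step ([first_step_gap]); this is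
    [gap_bound]. Both announced rates are this bound with [A] evaluated:
    [(1 - alpha)^(t - 1)] in the strongly convex case, where moreover
    [|x0 - xs|^2 <= 2 (f x0 - f xs) / lambda] ([quadratic_growth]), and
    [6 / (t (t + 1) (t + 2))] in the convex case.

    The upper bound holds because the linear models added to [phi] lie below [f].
    The lower bound is an induction. [phi t] is uniformly convex
    ([phi_unif_convex]): away from its minimizer [y t] it grows at least like a
    quadratic plus a cubic. Adding a linear model with slope
    [g = grad f (x (t + 1))] can lower its minimum by what the objective of the
    auxiliary point [xbar t] measures, and this loss has to be paid by
    [<g, w t - x (t + 1)> / A t]. The payment is the main estimate
    ([cubic_step_progress]): for every [v >= 0],
    [|g| v <= <g, w t - x (t + 1)> + (3/8) mu v^2 + (gamma/2) v^3].
    With [v = alpha t * |z - y t|] it reduces the induction step to a comparison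
    of the coefficients of the quadratic and of the cubic ([step_condition]),
    which is where the choice of the parameters enters
    ([strongly_convex_step_scalar], [convex_step_scalar]).

    The main estimate rests on the Taylor bounds for a Lipschitz Hessian, on the
    optimality condition of the cubic model, and on the symmetry of the Hessian:
    the hypothesis bounds the quadratic form of [H - hess f w] between [mu / 2] and
    [mu], and symmetry turns this into the bound [mu / 4] for the norm of
    [H - hess f w - 3 mu / 4] ([sym_form_enorm], [hess_sym]). *)

(** Real arithmetic in which inner products, norms and function values are
    generalized to fresh variables beforehand, so that two of them are compared
    syntactically rather than by conversion. *)
Ltac generalize_atoms :=
  repeat match goal with
  | H : is_true (_ <= _) |- _ => revert H
  | H : is_true (_ < _) |- _ => revert H
  end;
  repeat match goal with
  | |- context [?g ?x] =>
      lazymatch type of (g x) with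
      | Real.sort _ => generalize (g x); intro
      end
  end.
Ltac vlra := generalize_atoms; intros; lra.

(** * The Euclidean inner product and the spectral norm *)

Section InnerProduct.
Context {R : realType} {n : nat}.
Implicit Types (u v w : 'cV[R]_n) (A B : 'M[R]_n) (a : R).

Lemma dotvC u v : dotv u v = dotv v u.
Proof. by apply: eq_bigr => i _; rewrite mulrC. Qed.

Lemma dotvDl u v w : dotv (u + v) w = dotv u w + dotv v w.
Proof. by rewrite -big_split; apply: eq_bigr => i _; rewrite mxE mulrDl. Qed.

Lemma dotvZl a u v : dotv (a *: u) v = a * dotv u v.
Proof. by rewrite mulr_sumr; apply: eq_bigr => i _; rewrite mxE mulrA. Qed.

Lemma dotvDr u v w : dotv u (v + w) = dotv u v + dotv u w.
Proof. by rewrite dotvC dotvDl !(dotvC _ u). Qed.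

Lemma dotvZr a u v : dotv u (a *: v) = a * dotv u v.
Proof. by rewrite dotvC dotvZl dotvC. Qed.

Lemma dotvNl u v : dotv (- u) v = - dotv u v.
Proof. by rewrite -scaleN1r dotvZl mulN1r. Qed.

Lemma dotvNr u v : dotv u (- v) = - dotv u v.
Proof. by rewrite dotvC dotvNl dotvC. Qed.

Lemma dotv0l v : dotv 0 v = 0.
Proof. by rewrite -(scale0r 0) dotvZl mul0r. Qed.

Lemma dotv0r v : dotv v 0 = 0.
Proof. by rewrite dotvC dotv0l. Qed.

Definition dotvE := (dotvDl, dotvDr, dotvNl, dotvNr, dotvZl, dotvZr).

Lemma dotv_trmx A u v : dotv (A *m u) v = dotv u (A^T *m v).
Proof.
rewrite /dotv; under eq_bigr => i _ do rewrite mxE mulr_suml.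
rewrite exchange_big; apply: eq_bigr => i _.
rewrite mxE mulr_sumr; apply: eq_bigr => j _.
by rewrite !mxE mulrAC mulrC mulrA.
Qed.

Lemma form_Dl A u v w : dotv (A *m (u + v)) w = dotv (A *m u) w + dotv (A *m v) w.
Proof. by rewrite mulmxDr dotvDl. Qed.

Lemma form_Zl A a u w : dotv (A *m (a *: u)) w = a * dotv (A *m u) w.
Proof. by rewrite -scalemxAr dotvZl. Qed.

Lemma form_Bl A B u v : dotv ((A - B) *m u) v = dotv (A *m u) v - dotv (B *m u) v.
Proof. by rewrite mulmxBl dotvDl dotvNl. Qed.

Lemma form_scalar a u v : dotv (a%:M *m u) v = a * dotv u v.
Proof. by rewrite mul_scalar_mx dotvZl. Qed.

Lemma form_symC A u v : A^T = A -> dotv (A *m u) v = dotv (A *m v) u.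
Proof. by move=> Asym; rewrite dotv_trmx Asym dotvC. Qed.

Lemma dotvv_ge0 u : 0 <= dotv u u.
Proof. by apply: sumr_ge0 => i _; rewrite -expr2 sqr_ge0. Qed.

Lemma dotvv_eq0 u : dotv u u = 0 -> u = 0.
Proof.
move=> /psumr_eq0P u0; apply/matrixP => i j; rewrite ord1 mxE.
apply/eqP; rewrite -sqrf_eq0 expr2 u0// => k _.
by rewrite -expr2 sqr_ge0.
Qed.

Lemma enorm_ge0 u : 0 <= enorm u. Proof. exact: sqrtr_ge0. Qed.

Lemma enorm_sqr u : enorm u ^+ 2 = dotv u u.
Proof. by rewrite sqr_sqrtr ?dotvv_ge0. Qed.

Lemma enorm_eq0 u : enorm u = 0 -> u = 0.
Proof. by move=> u0; apply: dotvv_eq0; rewrite -enorm_sqr u0 expr0n. Qed.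

Lemma enorm0 : enorm (0 : 'cV[R]_n) = 0.
Proof. by rewrite /enorm dotv0l sqrtr0. Qed.

Lemma enormZ a u : 0 <= a -> enorm (a *: u) = a * enorm u.
Proof.
move=> a0; rewrite /enorm !dotvE mulrA -expr2.
by rewrite sqrtrM ?sqr_ge0// sqrtr_sqr ger0_norm.
Qed.

Lemma enormN u : enorm (- u) = enorm u.
Proof. by rewrite /enorm dotvNl dotvNr opprK. Qed.

Lemma enorm_le u a : 0 <= a -> dotv u u <= a ^+ 2 -> enorm u <= a.
Proof.
by move=> a0 ua; rewrite -(ler_pXn2r (ltn0Sn 1)) ?nnegrE ?enorm_ge0 ?enorm_sqr.
Qed.

Lemma cauchy_schwarz u v : dotv u v <= enorm u * enorm v.
Proof.
have [/eqP|uv0] := eqVneq (enorm u * enorm v) 0.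
  by rewrite mulf_eq0 => /orP[]/eqP/enorm_eq0->;
    rewrite (dotv0l, dotv0r) mulr_ge0 ?enorm_ge0.
have uv_gt0 : 0 < enorm u * enorm v by rewrite lt_def uv0 mulr_ge0 ?enorm_ge0.
have := dotvv_ge0 (enorm v *: u - enorm u *: v).
rewrite !dotvE (dotvC v u) -!enorm_sqr => h.
rewrite -(ler_pM2l uv_gt0); lra.
Qed.

Lemma cauchy_schwarz_opp u v : - (enorm u * enorm v) <= dotv u v.
Proof. by have := cauchy_schwarz (- u) v; rewrite dotvNl enormN; lra. Qed.

Lemma enormD u v : enorm (u + v) <= enorm u + enorm v.
Proof.
apply: enorm_le; first by rewrite addr_ge0 ?enorm_ge0.
rewrite !dotvE (dotvC v u) -!enorm_sqr; have := cauchy_schwarz u v; lra.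
Qed.

Lemma ler_enorm_dist u v : (enorm (u + v) - enorm u) ^+ 2 <= enorm v ^+ 2.
Proof.
have h1 := enormD u v.
have := enormD (u + v) (- v); rewrite addrK enormN => h2.
rewrite -subr_ge0 subr_sqr mulr_ge0//; lra.
Qed.

Lemma enormD_sqr u v :
  enorm (u + v) ^+ 2 = enorm u ^+ 2 + 2 * dotv u v + enorm v ^+ 2.
Proof. by rewrite !enorm_sqr !dotvE (dotvC v u); ring. Qed.

(** The set whose supremum is the spectral norm is bounded by the Frobenius
    norm. *)
Lemma specnorm_ub A v : enorm (A *m v) <= specnorm A * enorm v.
Proof.
have bounded : has_ubound [set enorm (A *m v) | v in [set v : 'cV[R]_n | enorm v <= 1]].
  exists (Num.sqrt (\sum_i dotv (row i A)^T (row i A)^T)) => _ [z /= z1 <-].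
  rewrite ler_sqrt; last by apply: sumr_ge0 => i _; exact: dotvv_ge0.
  apply: ler_sum => i _.
  have -> : (A *m z) i 0 = dotv (row i A)^T z.
    by rewrite mxE; apply: eq_bigr => j _; rewrite !mxE.
  rewrite -expr2; set r := (row i A)^T.
  have hr : enorm r * enorm z <= enorm r by rewrite ler_piMr ?enorm_ge0.
  have h1 := cauchy_schwarz r z; have h2 := cauchy_schwarz_opp r z.
  rewrite -enorm_sqr -subr_ge0 subr_sqr mulr_ge0//; lra.
have [v0|v0] := eqVneq (enorm v) 0.
  by rewrite v0 mulr0 (enorm_eq0 _ v0) mulmx0 enorm0.
have v_gt0 : 0 < enorm v by rewrite lt_def v0 enorm_ge0.
have inv_ge0 : 0 <= (enorm v)^-1 by rewrite invr_ge0 enorm_ge0.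
rewrite -ler_pdivrMr// mulrC -enormZ// scalemxAr.
by apply: ub_le_sup => //; exists ((enorm v)^-1 *: v) => //=; rewrite enormZ// mulVf.
Qed.

(** For symmetric [B] the quadratic form controls the norm, by the polarization
    [4 <B s, t> = <B (s + t), s + t> - <B (s - t), s - t>] taken at a multiple
    [t] of [B s] that has the length of [s]. *)
Lemma sym_form_enorm B (k : R) s : B^T = B -> 0 <= k ->
  (forall v, - (k * dotv v v) <= dotv (B *m v) v <= k * dotv v v) ->
  enorm (B *m s) <= k * enorm s.
Proof.
move=> Bsym k0 Bk.
have [s0|s0] := eqVneq (enorm s) 0.
  by rewrite (enorm_eq0 _ s0) mulmx0 enorm0 mulr0.
have s_gt0 : 0 < enorm s by rewrite lt_def s0 enorm_ge0.
have [t0|t0] := eqVneq (enorm (B *m s)) 0.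
  by rewrite t0 mulr_ge0 ?enorm_ge0.
have t_gt0 : 0 < enorm (B *m s) by rewrite lt_def t0 enorm_ge0.
(* The scaling makes |t| = |s|, so that the bounds add up to 4 k |s|^2. *)
pose t := (enorm s / enorm (B *m s)) *: (B *m s).
have tt : dotv t t = enorm s ^+ 2.
  by rewrite -enorm_sqr enormZ ?divr_ge0 ?enorm_ge0// mulfVK.
have Bst : dotv (B *m s) t = enorm s * enorm (B *m s).
  by rewrite dotvZr -enorm_sqr; field.
have Bts : dotv (B *m t) s = dotv (B *m s) t by rewrite dotv_trmx Bsym dotvC.
clearbody t.
have /andP[_] := Bk (s + t); have /andP[+ _] := Bk (s - t).
rewrite mulmxBr mulmxDr !dotvE Bts (dotvC t s) -(enorm_sqr s) tt Bst => h1 h2.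
rewrite -(ler_pM2l s_gt0); lra.
Qed.

End InnerProduct.

(** * Taylor bounds from a Lipschitz Hessian *)

Section Taylor.
Context {R : realType}.

(** The mean value theorem, applied to the difference of [p] and the primitive of
    the quadratic bound, replaces the integral form of Taylor's remainder. *)
Lemma quadratic_slope_bound (p p' : R -> R) (a b c : R) :
  (forall s : R, is_derive s 1 p (p' s)) ->
  (forall s, 0 <= s -> s <= 1 -> p' s <= a + b * s + c * s ^+ 2) ->
  p 1 - p 0 <= a + b / 2 + c / 3.
Proof.
move=> dp p'le.
pose q := p - (a *: id + (b / 2) *: id ^+ 2 + (c / 3) *: id ^+ 3).
have dq (s : R) : is_derive s 1 q (p' s - (a + b * s + c * s ^+ 2)).
  have d1 : is_derive s (1 : R) (@id R) 1 by exact: is_derive_id.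
  have d2 := @is_deriveX _ _ _ 2 _ _ _ d1; have d3 := @is_deriveX _ _ _ 3 _ _ _ d1.
  have d123 := is_deriveD (is_deriveD (is_deriveZ a d1) (is_deriveZ (b / 2) d2))
    (is_deriveZ (c / 3) d3).
  apply: (is_derive_eq (is_deriveB (dp s) d123)).
  by rewrite /GRing.scale /= expr1; lra.
have cq : {within `[0 : R, 1], continuous q}.
  apply: continuous_subspaceT => r.
  by apply/differentiable_continuous/derivable1_diffP; case: (dq r).
have [s /itvP s01] := MVT ltr01 (fun s _ => dq s) cq.
rewrite subr0 mulr1 => qs.
have := p'le s; rewrite !s01 => /(_ isT isT).
rewrite -subr_le0 -qs /q /=.
rewrite !fctE /GRing.scale /=; lra.
Qed.

Context {n : nat}.
Implicit Types (f : 'cV[R]_n -> R) (w x d u v : 'cV[R]_n).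

Lemma derive_grad f x d : differentiable f x -> 'D_d f x = dotv (grad f x) d.
Proof.
move=> df; rewrite deriveE// {1}(matrix_sum_delta d) linear_sum.
apply: eq_bigr => i _; rewrite big_ord1 linearZ/= mxE deriveE//.
by rewrite mulrC.
Qed.

Lemma is_derive_line f w d (s : R) : differentiable f (w + s *: d) ->
  is_derive s 1 (fun s : R => f (w + s *: d)) (dotv (grad f (w + s *: d)) d).
Proof.
move=> df; rewrite -derive_grad//.
have : derivable f (w + s *: d) d by exact: diff_derivable.
pose q1 (h : R) := h^-1 *: ((f \o shift (w + s *: d)) (h *: d) - f (w + s *: d)).
pose q2 (h : R) := h^-1 *: (((fun s : R => f (w + s *: d)) \o shift s) h%:A
                           - f (w + s *: d)).
have q12 : q1 = q2.
  by apply/funext => h; rewrite /q1 /q2 /= -[h%:A]/(h * 1) mulr1 scalerDl addrCA.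
rewrite /derivable -/q1 q12 => fd.
by apply: DeriveDef => //; rewrite /derive -/q1 q12.
Qed.

Lemma is_derive_grad_line f w d v (s : R) :
  differentiable (grad f) (w + s *: d) ->
  is_derive s 1 (fun s : R => dotv (grad f (w + s *: d)) v)
    (dotv (hess f (w + s *: d) *m d) v).
Proof.
move=> df; set z := w + s *: d.
pose h (i : 'I_n) := v i 0 *: (fun s : R => grad f (w + s *: d) i 0).
have dh i : is_derive s 1 (h i) ((hess f z *m d) i 0 * v i 0).
  have gi : differentiable (fun z => grad f z i 0) z.
    exact: (differentiable_comp df (differentiable_coord (grad f z) i 0)).
  have := is_derive_line _ _ _ _ gi.
  have -> : dotv (grad (fun z => grad f z i 0) z) d = (hess f z *m d) i 0.
    by rewrite mxE; apply: eq_bigr => j _; rewrite !mxE.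
  by move=> ?; apply: is_derive_eq; rewrite mulrC.
have := is_derive_sum dh.
rewrite (_ : \sum_i h i = fun s => dotv (grad f (w + s *: d)) v)//.
by apply/funext => r; rewrite fct_sumE; apply: eq_bigr => i _; rewrite /h mulrC.
Qed.

Section Lipschitz.
Variables (gamma : R) (f : 'cV[R]_n -> R).
Hypotheses (hC2 : twice_cont_diff f) (hlip : hess_lipschitz gamma f).

Lemma hess_lipschitz_form w x u v :
  dotv (hess f x *m u) v - dotv (hess f w *m u) v <=
  gamma * enorm (x - w) * enorm u * enorm v.
Proof.
rewrite -dotvNl -dotvDl -mulmxBl; apply: le_trans (cauchy_schwarz _ _) _.
rewrite ler_wpM2r ?enorm_ge0//; apply: le_trans (specnorm_ub _ _) _.
by rewrite ler_wpM2r ?enorm_ge0.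
Qed.

(** Testing against a direction [v] reduces the remainder of the gradient, a
    vector, to that of a real function on a segment; [- v] gives the reverse
    inequality. *)
Lemma grad_taylor w d v :
  dotv (grad f (w + d)) v <= dotv (grad f w) v + dotv (hess f w *m d) v
    + gamma / 2 * enorm d ^+ 2 * enorm v.
Proof.
have [_ df _] := hC2.
have := @quadratic_slope_bound (fun s => dotv (grad f (w + s *: d)) v) _
  (dotv (hess f w *m d) v) (gamma * enorm d ^+ 2 * enorm v) 0
  (fun s => is_derive_grad_line _ _ _ _ _ (df _)).
rewrite /= scale1r scale0r addr0 => H.
suff: forall s, 0 <= s -> s <= 1 -> dotv (hess f (w + s *: d) *m d) v <=
    dotv (hess f w *m d) v + gamma * enorm d ^+ 2 * enorm v * s + 0 * s ^+ 2.
  by move=> /H; vlra.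
move=> s s0 s1; have := hess_lipschitz_form w (w + s *: d) d v.
have -> : w + s *: d - w = s *: d by rewrite addrAC subrr add0r.
rewrite enormZ//; vlra.
Qed.

Lemma taylor_ub w d :
  f (w + d) <= f w + dotv (grad f w) d + 2^-1 * dotv (hess f w *m d) d
    + gamma / 6 * enorm d ^+ 3.
Proof.
have [df _ _] := hC2.
have := @quadratic_slope_bound (fun s => f (w + s *: d)) _
  (dotv (grad f w) d) (dotv (hess f w *m d) d) (gamma / 2 * enorm d ^+ 3)
  (fun s => is_derive_line _ _ _ _ (df _)).
rewrite /= scale1r scale0r addr0 => H.
suff: forall s, 0 <= s -> s <= 1 -> dotv (grad f (w + s *: d)) d <=
    dotv (grad f w) d + dotv (hess f w *m d) d * s
    + gamma / 2 * enorm d ^+ 3 * s ^+ 2.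
  by move=> /H; vlra.
move=> s s0 s1; have := grad_taylor w (s *: d) d.
rewrite enormZ// form_Zl; vlra.
Qed.

Lemma taylor_lb w d :
  f w + dotv (grad f w) d + 2^-1 * dotv (hess f w *m d) d
    - gamma / 6 * enorm d ^+ 3 <= f (w + d).
Proof.
have [df _ _] := hC2.
have dNf (s : R) : is_derive s 1 (- fun s : R => f (w + s *: d))
    (- dotv (grad f (w + s *: d)) d).
  by apply: is_deriveN; exact: is_derive_line.
have := @quadratic_slope_bound _ _
  (- dotv (grad f w) d) (- dotv (hess f w *m d) d) (gamma / 2 * enorm d ^+ 3)
  dNf.
rewrite !fctE /= scale1r scale0r addr0 => H.
suff: forall s, 0 <= s -> s <= 1 -> - dotv (grad f (w + s *: d)) d <=
    - dotv (grad f w) d + - dotv (hess f w *m d) d * s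
    + gamma / 2 * enorm d ^+ 3 * s ^+ 2.
  by move=> /H; vlra.
move=> s s0 s1; have := grad_taylor w (s *: d) (- d).
rewrite enormN enormZ// form_Zl !dotvNr; vlra.
Qed.

End Lipschitz.
End Taylor.

(** * Consequences of the Taylor bounds *)

Section Consequences.
Context {R : realType} {n : nat}.
Implicit Types (s d p u v w x z : 'cV[R]_n).

(** The limit [h -> 0] behind every first-order argument below: all remainders
    are explicitly [O(h)] after division by the step [h]. *)
Lemma le0_of_le_small (p C : R) :
  (forall h : R, 0 < h -> h < 1 -> p <= C * h) -> p <= 0.
Proof.
move=> pC; rewrite leNgt; apply/negP => p_gt0.
have nC := normr_ge0 C; have Cn := ler_norm C.
have d_gt0 : 0 < `|C| + p by lra.
pose h := p / (`|C| + p) / 2.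
have h_gt0 : 0 < h by rewrite !divr_gt0.
have hd : h * (`|C| + p) = p / 2 by rewrite /h; field; lra.
have h_lt1 : h < 1.
  have : p / (`|C| + p) <= 1 by rewrite ler_pdivrMr// mul1r; lra.
  by rewrite /h; lra.
have := pC _ h_gt0 h_lt1.
have : C * h <= `|C| * h by rewrite ler_wpM2r// ltW.
have : 0 < p * h by rewrite mulr_gt0.
lra.
Qed.

Section Lipschitz.
Variables (gamma : R) (f : 'cV[R]_n -> R).
Hypotheses (hC2 : twice_cont_diff f) (hlip : hess_lipschitz gamma f).

(** The expansion of [f (w + h u + h v)] at [w] involves [hess f w] only through
    its symmetrization; expanding at [w + h u] instead, and then its value and
    gradient at [w], isolates [<hess f w u, v>]. The two agree up to [O(h^3)],
    with [C h^3] the sum of the remainders. *)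
Lemma hess_form_le w u v : dotv (hess f w *m u) v <= dotv (hess f w *m v) u.
Proof.
rewrite -subr_le0.
pose C := gamma * (enorm v ^+ 3 + enorm (u + v) ^+ 3 + enorm u ^+ 3
  + 3 * enorm u ^+ 2 * enorm v + 3 * enorm u * enorm v ^+ 2) / 3.
apply: (@le0_of_le_small _ C) => h h0 h1.
have h0' := ltW h0.
have e1 := taylor_lb _ _ hC2 hlip (w + h *: u) (h *: v).
have e2 := taylor_ub _ _ hC2 hlip w (h *: (u + v)).
have e3 := taylor_lb _ _ hC2 hlip w (h *: u).
have e4 := grad_taylor _ _ hC2 hlip w (h *: u) (- v).
have e5 := hess_lipschitz_form _ _ hlip (w + h *: u) w v v.
have uv : w + h *: u + h *: v = w + h *: (u + v) by rewrite scalerDr addrA.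
have wu : w - (w + h *: u) = - (h *: u) by rewrite opprD addrA subrr add0r.
rewrite uv form_Zl dotvZr dotvZr (enormZ _ _ h0') in e1.
rewrite form_Zl form_Dl !dotvZr !dotvDr (enormZ _ _ h0') in e2.
rewrite form_Zl !dotvZr (enormZ _ _ h0') in e3.
rewrite form_Zl !dotvNr enormN (enormZ _ _ h0') in e4.
rewrite wu enormN (enormZ _ _ h0') in e5.
rewrite -(ler_pM2l (exprn_gt0 2 h0)) /C.
have := ler_wpM2l h0' e4; have := ler_wpM2l (sqr_ge0 h) e5.
vlra.
Qed.

(** Schwarz's theorem; the norm estimate for [H - hess f w] needs it. *)
Lemma hess_sym w : (hess f w)^T = hess f w.
Proof.
have entry (A : 'M[R]_n) i j : A i j = dotv (A *m delta_mx j 0) (delta_mx i 0).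
  rewrite -colE /dotv (bigD1 i)//= big1 => [|k ki].
    by rewrite !mxE !eqxx mulr1 addr0.
  by rewrite !mxE (negPf ki) mulr0.
apply/matrixP => i j; rewrite mxE !entry.
by apply/eqP; rewrite eq_le !hess_form_le.
Qed.

(** Strong convexity on the segment from [w] to [z], with [f (w + h (z - w))]
    bounded below by its expansion; division by [h] leaves the gradient
    inequality. *)
Lemma strongly_convex_grad lambda w z : strongly_convex lambda f ->
  f w + dotv (grad f w) (z - w) + lambda / 2 * enorm (z - w) ^+ 2 <= f z.
Proof.
move=> fsc; set d := z - w; rewrite -subr_le0.
pose C := lambda / 2 * enorm d ^+ 2 + gamma / 6 * enorm d ^+ 3
  + `|dotv (hess f w *m d) d| / 2 + `|gamma| * enorm d ^+ 3.
apply: (@le0_of_le_small _ C) => h h0 h1.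
have h0' := ltW h0; have h1' := ltW h1.
have := fsc z w _ h0' h1'.
have -> : h *: z + (1 - h) *: w = w + h *: d.
  by rewrite scalerBl scale1r scalerBr addrCA.
have := taylor_lb _ _ hC2 hlip w (h *: d).
rewrite form_Zl !dotvZr !(enormZ _ _ h0') -/d => e1 e2.
rewrite -(ler_pM2l h0) /C.
have h2 : 0 <= h ^+ 2 by exact: sqr_ge0.
have : `|gamma| * enorm d ^+ 3 * h ^+ 3 <= `|gamma| * enorm d ^+ 3 * h ^+ 2.
  rewrite ler_wpM2l ?mulr_ge0 ?exprn_ge0 ?enorm_ge0// exprS ler_piMl//.
have : gamma * enorm d ^+ 3 * h ^+ 3 <= `|gamma| * enorm d ^+ 3 * h ^+ 3.
  by rewrite !ler_wpM2r ?exprn_ge0 ?enorm_ge0// ler_norm.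
have : - `|gamma| * enorm d ^+ 3 * h ^+ 2 <= gamma * enorm d ^+ 3 * h ^+ 2.
  by rewrite !ler_wpM2r ?exprn_ge0 ?enorm_ge0// lerNl -normrN ler_norm.
have : - `|dotv (hess f w *m d) d| * h ^+ 2 <= dotv (hess f w *m d) d * h ^+ 2.
  by rewrite ler_wpM2r// lerNl -normrN ler_norm.
have : 0 <= `|gamma| * enorm d ^+ 3 * h ^+ 2.
  by rewrite !mulr_ge0 ?exprn_ge0 ?enorm_ge0.
vlra.
Qed.

End Lipschitz.

(** * The cube of the norm, and optimality conditions *)

(** With [a = |s|], [b = |s + d|] and [b^2 - a^2 = 2 <s, d> + |d|^2], this is
    [b^3 - a^3 - (3/2) a (b^2 - a^2) = (b - a)^2 (b + a / 2)]. *)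
Lemma enorm_cubeD s d :
  enorm (s + d) ^+ 3 = enorm s ^+ 3 + 3 * enorm s * dotv s d
    + 3 / 2 * enorm s * enorm d ^+ 2
    + (enorm (s + d) - enorm s) ^+ 2 * (enorm (s + d) + enorm s / 2).
Proof.
have -> : dotv s d = (enorm (s + d) ^+ 2 - enorm s ^+ 2 - enorm d ^+ 2) / 2.
  by rewrite enormD_sqr; field.
by field.
Qed.

Lemma enorm_cube_ub s d :
  enorm (s + d) ^+ 3 <= enorm s ^+ 3 + 3 * enorm s * dotv s d
    + 3 * enorm s * enorm d ^+ 2 + enorm d ^+ 3.
Proof.
rewrite enorm_cubeD.
have sd := enormD s d; have s0 := enorm_ge0 s; have d0 := enorm_ge0 d.
have : (enorm (s + d) - enorm s) ^+ 2 * (enorm (s + d) + enorm s / 2)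
   <= enorm d ^+ 2 * (3 / 2 * enorm s + enorm d).
  apply: ler_pM; rewrite ?sqr_ge0 ?ler_enorm_dist//.
    by rewrite addr_ge0 ?divr_ge0 ?enorm_ge0.
  by vlra.
vlra.
Qed.

(** Uniform convexity of the cube of the norm. Given [a = |s|] and [b = |s + d|],
    the remainder [(b - a)^2 (b + a / 2) + delta^2 (3 a - delta) / 2] can only be
    negative for [delta = |d| > 3 a]; there it decreases in [delta], and at the
    largest possible value [a + b] it equals [(b - a)^3 / 2 + 2 a^3]. *)
Lemma enorm_cube_lb s d :
  enorm s ^+ 3 + 3 * enorm s * dotv s d + 2^-1 * enorm d ^+ 3
    <= enorm (s + d) ^+ 3.
Proof.
rewrite [leRHS]enorm_cubeD.
have sd : enorm d <= enorm s + enorm (s + d).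
  have := enormD (- s) (s + d); rewrite addrA addNr add0r enormN; vlra.
have : 0 <= enorm s := enorm_ge0 s; have : 0 <= enorm d := enorm_ge0 d.
have : 0 <= enorm (s + d) := enorm_ge0 _.
suff : forall a b x : R, 0 <= b -> 0 <= x -> 0 <= a -> x <= a + b ->
    0 <= (b - a) ^+ 2 * (b + a / 2) + x ^+ 2 * (3 * a - x) / 2.
  move=> H b0 d0 s0; have := H _ _ _ b0 d0 s0 sd; vlra.
move=> a b x b0 x0 a0 xab.
have [x3|x3] := leP x (3 * a).
  rewrite addr_ge0// ?divr_ge0// mulr_ge0 ?sqr_ge0//; lra.
have y0 : 0 <= a + b - x by lra.
have x3' : 0 <= x - 3 * a by lra.
have -> : (b - a) ^+ 2 * (b + a / 2) + x ^+ 2 * (3 * a - x) / 2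
  = ((b - a) ^+ 3 + 4 * a ^+ 3) / 2
    + ((a + b) ^+ 2 * (b - 2 * a) - x ^+ 2 * (x - 3 * a)) / 2.
  by field.
have b2a : 0 <= b - 2 * a by lra.
have h1 : 0 <= (b - a) ^+ 3 + 4 * a ^+ 3.
  rewrite addr_ge0// ?mulr_ge0 ?exprn_ge0//; lra.
have h2 : x ^+ 2 * (x - 3 * a) <= (a + b) ^+ 2 * (b - 2 * a).
  apply: ler_pM => //; rewrite ?sqr_ge0//; last by lra.
  by rewrite lerXn2r ?nnegrE//; lra.
lra.
Qed.

(** A one-sided first-order condition: an upper expansion at a minimizer suffices
    to exclude a descent direction [- p]. It applies to functions that involve
    the cube of the norm without differentiating the norm at [0]. *)
Lemma argmin_slope0 (g : 'cV[R]_n -> R) s p (K L : R) : is_argmin g s ->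
  (forall d, g (s + d) <= g s + dotv p d + K * enorm d ^+ 2 + L * enorm d ^+ 3) ->
  p = 0.
Proof.
move=> smin gub; apply: dotvv_eq0; apply/eqP; rewrite eq_le dotvv_ge0 andbT.
pose C := `|K| * enorm p ^+ 2 + `|L| * enorm p ^+ 3.
apply: (@le0_of_le_small _ C) => h h0 h1.
have h0' := ltW h0; have h1' := ltW h1.
have := le_trans (smin _) (gub (h *: (- p))).
rewrite enormZ// enormN dotvZr dotvNr => e.
rewrite -(ler_pM2l h0) /C.
have h2 : 0 <= h ^+ 2 by exact: sqr_ge0.
have : `|L| * enorm p ^+ 3 * h ^+ 3 <= `|L| * enorm p ^+ 3 * h ^+ 2.
  rewrite ler_wpM2l ?mulr_ge0 ?exprn_ge0 ?enorm_ge0// exprS ler_piMl//.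
have : L * enorm p ^+ 3 * h ^+ 3 <= `|L| * enorm p ^+ 3 * h ^+ 3.
  by rewrite !ler_wpM2r ?exprn_ge0 ?enorm_ge0// ler_norm.
have : K * enorm p ^+ 2 * h ^+ 2 <= `|K| * enorm p ^+ 2 * h ^+ 2.
  by rewrite !ler_wpM2r ?exprn_ge0 ?enorm_ge0// ler_norm.
vlra.
Qed.

Lemma argmin_cubic_model (f : 'cV[R]_n -> R) (H : 'M[R]_n) (c : R) w x :
  H^T = H -> 0 <= c -> is_argmin (cubic_model f H c w) x ->
  grad f w + H *m (x - w) + (c / 2 * enorm (x - w)) *: (x - w) = 0.
Proof.
move=> Hsym c0 xmin; set s := x - w.
have [K HK] : exists K, forall d, dotv (H *m d) d <= K * enorm d ^+ 2.
  exists (specnorm H) => d; apply: le_trans (cauchy_schwarz _ _) _.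
  by rewrite expr2 mulrA ler_wpM2r ?enorm_ge0 ?specnorm_ub.
apply: (@argmin_slope0 _ _ _ (K / 2 + c / 2 * enorm s) (c / 6) xmin) => d.
have sd : x + d - w = s + d by rewrite addrAC.
rewrite /cubic_model sd -/s; clearbody s; rewrite form_Dl !dotvE.
have -> : dotv (H *m d) s = dotv (H *m s) d by exact: form_symC.
have := ler_wpM2l c0 (enorm_cube_ub s d); have := HK d.
vlra.
Qed.

End Consequences.

(** * The progress of one cubic step *)

Section Step.
Context {R : realType}.

(** The core of the step estimate, with [G], [r], [D] standing for [|g|], [|s|],
    [- <g, s>] and [c = 3 mu / 4 + 2 gamma r]. Multiplying the claim by [2 c] and
    completing the square in [G] leaves [c gamma (15/8 r^3 - 2 r v^2 + v^3) >= 0],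
    which holds because [(v - 4/3 r)^2 (v + 2/3 r) >= 0]. *)
Lemma step_progress_scalar (mu gamma G r v D : R) :
  0 <= mu -> 0 < gamma -> 0 <= G -> 0 <= r -> 0 <= v -> - (G * r) <= D ->
  G ^+ 2 - 2 * (3 / 4 * mu + 2 * gamma * r) * D
    + (3 / 4 * mu + 2 * gamma * r) ^+ 2 * r ^+ 2
    <= ((mu / 4 + gamma / 2 * r) * r) ^+ 2 ->
  G * v <= D + 3 / 8 * mu * v ^+ 2 + gamma / 2 * v ^+ 3.
Proof.
move=> mu0 gam0 G0 r0 v0 GrD.
have gam0' := ltW gam0.
have gr0 : 0 <= gamma * r by rewrite mulr_ge0.
set c := 3 / 4 * mu + 2 * gamma * r => main.
have c0 : 0 <= c by rewrite /c; lra.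
have [c_eq0|c_neq0] := eqVneq c 0.
  have mu_eq0 : mu = 0 by rewrite /c in c_eq0; lra.
  have gr_eq0 : gamma * r = 0 by rewrite /c in c_eq0; lra.
  have r_eq0 : r = 0.
    by move/eqP: gr_eq0; rewrite mulf_eq0 gt_eqF//= => /eqP.
  move: main GrD; rewrite c_eq0 r_eq0 mu_eq0 => main GrD.
  have G_eq0 : G = 0.
    apply/eqP; rewrite -sqrf_eq0 eq_le sqr_ge0 andbT; lra.
  have : 0 <= gamma * v ^+ 3 by rewrite mulr_ge0 ?exprn_ge0.
  rewrite G_eq0; lra.
have c_gt0 : 0 < 2 * c by rewrite mulr_gt0// lt_def c_neq0.
(* c - (mu / 4 + gamma r / 2) and c + (mu / 4 + gamma r / 2) are
   mu / 2 + 3/2 gamma r and mu + 5/2 gamma r. *)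
have gap : 15 / 8 * (c * gamma * r) <= c ^+ 2 - (mu / 4 + gamma / 2 * r) ^+ 2.
  have : 0 <= mu * (gamma * r) by rewrite mulr_ge0.
  have : 0 <= mu ^+ 2 by exact: sqr_ge0.
  rewrite /c; lra.
have cubic : 0 <= c * gamma * (15 / 8 * r ^+ 3 - 2 * r * v ^+ 2 + v ^+ 3).
  rewrite mulr_ge0 ?mulr_ge0//.
  have : 0 <= (v - 4 / 3 * r) ^+ 2 * (v + 2 / 3 * r).
    by rewrite mulr_ge0 ?sqr_ge0//; lra.
  have : 0 <= r ^+ 3 by rewrite exprn_ge0.
  lra.
have gap_r := ler_wpM2r (sqr_ge0 r) gap.
have sq := sqr_ge0 (G - c * v).
have cv2 : c * v ^+ 2 * c = c * v ^+ 2 * (3 / 4 * mu + 2 * gamma * r) by [].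
rewrite -(ler_pM2l c_gt0); lra.
Qed.

Context {n : nat}.
Implicit Types (w x z u : 'cV[R]_n).

(** A cubic step from [w] to [x] makes [<grad f x, w - x>] large compared with
    [|grad f x|]; the claim is the Young-type inequality dual to this, and [v] is
    to be chosen. By the optimality of [x], [grad f x] differs from
    [- (3 mu / 4 + 2 gamma r) (x - w)], [r = |x - w|], only by the error
    [gamma r^2 / 2] of the Taylor expansion and by
    [(H - hess f w - 3 mu / 4) (x - w)], of norm at most [mu r / 4]. *)
Lemma cubic_step_progress (f : 'cV[R]_n -> R) (gamma mu : R) (H : 'M[R]_n) w x
    (v : R) :
  twice_cont_diff f -> hess_lipschitz gamma f -> 0 < gamma -> 0 <= mu ->
  H^T = H -> loewner_le (mu / 2)%:M (H - hess f w) ->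
  loewner_le (H - hess f w) mu%:M ->
  is_argmin (cubic_model f H (4 * gamma) w) x -> 0 <= v ->
  enorm (grad f x) * v <=
    dotv (grad f x) (w - x) + 3 / 8 * mu * v ^+ 2 + gamma / 2 * v ^+ 3.
Proof.
move=> hC2 hlip gam0 mu0 Hsym Elb Eub xmin v0.
have opt : grad f w + H *m (x - w) + (4 * gamma / 2 * enorm (x - w)) *: (x - w) = 0.
  by apply: argmin_cubic_model xmin => //; rewrite mulr_ge0// ltW.
have -> : w - x = - (x - w) by rewrite opprB.
have xE : x = w + (x - w) by rewrite addrC subrK.
move: opt xE; move: (x - w) => s opt xE.
have taylor (z : 'cV[R]_n) := grad_taylor _ _ hC2 hlip w s z.
rewrite -xE in taylor.
pose B := H - hess f w - (3 / 4 * mu)%:M.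
have Bsym : B^T = B by rewrite /B !linearB/= Hsym (hess_sym _ _ hC2 hlip) tr_scalar_mx.
have Bform z u : dotv (B *m z) u =
    dotv (H *m z) u - dotv (hess f w *m z) u - 3 / 4 * mu * dotv z u.
  by rewrite /B !form_Bl form_scalar.
have Bs : enorm (B *m s) <= mu / 4 * enorm s.
  apply: sym_form_enorm => //; first by rewrite divr_ge0.
  move=> z; rewrite Bform; have := Elb z; have := Eub z.
  rewrite !form_Bl !form_scalar => h1 h2.
  by apply/andP; split; vlra.
set c := 3 / 4 * mu + 2 * gamma * enorm s.
have r0 := enorm_ge0 s.
have grad_near : enorm (grad f x + c *: s) <= (mu / 4 + gamma / 2 * enorm s) * enorm s.
  (* Testing against z = grad f x + c s itself then gives the norm. *)
  have gc z : dotv (grad f x + c *: s) z <=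
      (mu / 4 + gamma / 2 * enorm s) * enorm s * enorm z.
    have := taylor z; have := congr1 (fun p => dotv p z) opt.
    rewrite dotv0l !dotvE => opt_z tz.
    have := cauchy_schwarz_opp (B *m s) z.
    have := ler_wpM2r (enorm_ge0 z) Bs.
    move: opt_z => /eqP; rewrite eq_le => /andP[].
    rewrite Bform /c; vlra.
  have := gc (grad f x + c *: s); rewrite -enorm_sqr expr2.
  have [->|nz] := eqVneq (enorm (grad f x + c *: s)) 0.
    move=> _; rewrite mulr_ge0//.
    have : 0 <= gamma * enorm s by rewrite mulr_ge0// ltW.
    vlra.
  by rewrite ler_pM2r// lt_def nz enorm_ge0.
apply: (step_progress_scalar mu gamma (enorm (grad f x)) (enorm s)) => //.
- exact: enorm_ge0.
- by rewrite dotvNr lerN2 cauchy_schwarz.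
- have : enorm (grad f x + c *: s) ^+ 2 <=
      ((mu / 4 + gamma / 2 * enorm s) * enorm s) ^+ 2.
    by rewrite lerXn2r ?nnegrE ?enorm_ge0// (le_trans (enorm_ge0 _) grad_near).
  rewrite enormD_sqr enormZ; last first.
    have : 0 <= gamma * enorm s by rewrite mulr_ge0// ltW.
    rewrite /c; vlra.
  rewrite -/c dotvZr dotvNr; clearbody c; vlra.
Qed.

End Step.

(** * Estimate sequences *)

Section EstimateSequence.
Context {R : realType} {n : nat}.
Implicit Types (z d p y : 'cV[R]_n).

(** First-order expansion with a lower remainder (uniform convexity) and some
    upper remainder. The latter only serves to make [p] vanish at a minimizer. *)
Definition unif_convex_expansion (kappa beta : R) (g : 'cV[R]_n -> R) : Prop :=
  forall y, exists p K L, forall d,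
    g y + dotv p d + kappa / 2 * enorm d ^+ 2 + beta / 12 * enorm d ^+ 3
      <= g (y + d) /\
    g (y + d) <= g y + dotv p d + K * enorm d ^+ 2 + L * enorm d ^+ 3.

Lemma unif_convex_argmin kappa beta g y z :
  unif_convex_expansion kappa beta g -> is_argmin g y ->
  g y + kappa / 2 * enorm (z - y) ^+ 2 + beta / 12 * enorm (z - y) ^+ 3 <= g z.
Proof.
move=> /(_ y)[p [K [L gE]]] ymin.
have p0 : p = 0 by exact: (argmin_slope0 _ _ _ K L ymin (fun d => proj2 (gE d))).
have [+ _] := gE (z - y).
by rewrite p0 dotv0l addr0 subrKC.
Qed.

Variables (f : 'cV[R]_n -> R) (gamma eta beta lambda : R).
Variables (alpha mubar mu : nat -> R) (x0 : 'cV[R]_n) (H : nat -> 'M[R]_n).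
Variables (w x y : nat -> 'cV[R]_n) (phi : nat -> 'cV[R]_n -> R).
Hypotheses (hgamma : 0 < gamma) (hC2 : twice_cont_diff f).
Hypothesis hlip : hess_lipschitz gamma f.
Hypothesis hrun : AINCR f gamma eta beta lambda alpha mubar x0 H w x y phi.
Hypothesis hmu : forall t, 0 <= mu t.
Hypothesis hH : forall t,
  loewner_le (mu t / 2)%:M (H t - hess f (w t)) /\
  loewner_le (H t - hess f (w t)) (mu t)%:M.

Lemma Aseq0 : Aseq alpha 0 = 1.
Proof. by rewrite /Aseq big_nil. Qed.

Lemma AseqS t : Aseq alpha t.+1 = Aseq alpha t * (1 - alpha t.+1).
Proof. by rewrite /Aseq big_nat_recr. Qed.

Lemma Aseq_gt0 t : 0 < Aseq alpha t.
Proof.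
elim: t => [|t IH]; first by rewrite Aseq0.
have /andP[_ a1] := aincr_alpha_itv hrun (ltn0Sn t).
by rewrite AseqS mulr_gt0// subr_gt0.
Qed.

Lemma Aseq_inv t : (Aseq alpha t)^-1 = (1 - alpha t.+1) / Aseq alpha t.+1.
Proof.
have /andP[_ a1] := aincr_alpha_itv hrun (ltn0Sn t).
by rewrite AseqS invfM mulrCA mulfV ?mulr1// gt_eqF// subr_gt0.
Qed.

Lemma weight_inv t :
  (Aseq alpha t.+1)^-1 = (Aseq alpha t)^-1 + alpha t.+1 / Aseq alpha t.+1.
Proof. by rewrite (Aseq_inv t) -mulrDl subrK mul1r. Qed.

Lemma weight_ge0 t : 0 <= alpha t.+1 / Aseq alpha t.+1.
Proof.
have /andP[a0 _] := aincr_alpha_itv hrun (ltn0Sn t).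
by rewrite divr_ge0 ?ltW ?Aseq_gt0.
Qed.

Lemma Aseq_inv_ge1 t : 1 <= (Aseq alpha t)^-1.
Proof.
elim: t => [|t IH]; first by rewrite Aseq0 invr1.
by rewrite weight_inv (le_trans IH)// lerDl weight_ge0.
Qed.

(** Every summand of [phi t] is a convex quadratic, affine, or the cube of a
    distance; the weights [alpha i / A i] of the quadratics of the linear
    models telescope to [1 / A (t - 1) - 1]. *)
Lemma phi_unif_convex t :
  unif_convex_expansion (mubar t + lambda * ((Aseq alpha t)^-1 - 1)) beta
    (phi t.+1).
Proof.
have b0 := aincr_beta_gt0 hrun.
elim: t => [|t IH] z.
  rewrite Aseq0 invr1 subrr mulr0 addr0.
  exists ((mubar 0 + beta / 2 * enorm (z - x0)) *: (z - x0)).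
  exists (mubar 0 / 2 + beta / 2 * enorm (z - x0)), (beta / 6) => d.
  have zd : z + d - x0 = z - x0 + d by rewrite addrAC.
  rewrite !(aincr_phi1 hrun) zd; move: (z - x0) => s.
  have lb := ler_wpM2l (ltW b0) (enorm_cube_lb s d).
  have ub := ler_wpM2l (ltW b0) (enorm_cube_ub s d).
  by rewrite enormD_sqr dotvZl; split; vlra.
have [p [K [L pE]]] := IH z; have wi := weight_inv t.
have phiE := aincr_phiS hrun (ltn0Sn t).
rewrite /= in phiE; move: wi phiE.
move: (alpha t.+1 / _) => a -> phiE.
exists (p + (mubar t.+1 - mubar t) *: (z - x0)
  + a *: (grad f (x t.+2) + lambda *: (z - x t.+2))).
exists (K + (mubar t.+1 - mubar t) / 2 + a * lambda / 2), L => d.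
have shift c : z + d - c = z - c + d by rewrite addrAC.
rewrite !phiE !shift; have [] := pE d.
move: (z - x0) (z - x t.+2) => s1 s2 lb ub.
by rewrite !enormD_sqr !(dotvDl, dotvZl) (dotvDr _ s2 d); split; vlra.
Qed.

(** The linear models lie below [f], and their weights [alpha i / A i], [i < t],
    sum up to [1 / A (t - 1) - 1]. The missing copy of [f z] is what the constant
    [f (x 1)] of [phi 1] replaces. *)
Lemma phi_ub t z :
  phi t.+1 z <= (Aseq alpha t)^-1 * f z + (f (x 1) - f z)
    + mubar t / 2 * enorm (z - x0) ^+ 2 + beta / 6 * enorm (z - x0) ^+ 3.
Proof.
elim: t => [|t IH]; first by rewrite (aincr_phi1 hrun) Aseq0 invr1; vlra.
rewrite (aincr_phiS hrun)//=; have wi := weight_inv t.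
have sc := strongly_convex_grad _ _ hC2 hlip _ (x t.+2) z (aincr_lambda_param hrun).
have := ler_wpM2l (weight_ge0 t) sc; move: wi.
by move: (alpha t.+1 / _) => a ->; vlra.
Qed.

(** [H 0] exceeds the Hessian, so the model lies above [f] at its minimizer
    [x 1]; at [z] it exceeds [f] by at most [mu 0 / 2 d^2] through [H 0] and
    twice [gamma / 6 d^3], once for the cubic term of the model and once for the
    Taylor remainder. *)
Lemma first_step_gap z :
  f (x 1) - f z <= mu 0 / 2 * enorm (z - x0) ^+ 2
    + gamma / 3 * enorm (z - x0) ^+ 3.
Proof.
have model z1 : cubic_model f (H 0) gamma x0 z1 = f x0 + dotv (grad f x0) (z1 - x0)
   + 2^-1 * dotv (H 0 *m (z1 - x0)) (z1 - x0) + gamma / 6 * enorm (z1 - x0) ^+ 3.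
  by [].
have := aincr_x1 hrun z; rewrite !model.
have [] := hH 0; rewrite (aincr_w0 hrun) => Elb Eub.
have tub := taylor_ub _ _ hC2 hlip x0 (x 1 - x0).
have tlb := taylor_lb _ _ hC2 hlip x0 (z - x0).
rewrite !subrKC in tub tlb.
have := Elb (x 1 - x0); have := Eub (z - x0).
rewrite !form_Bl !form_scalar -!enorm_sqr.
have := mulr_ge0 (hmu 0) (sqr_ge0 (enorm (x 1 - x0))).
vlra.
Qed.

(** The invariant [f (x t) / A (t - 1) <= min phi t]. By convexity at
    [x (t + 1)] and [w t = (1 - alpha t) x t + alpha t y t], the linear models
    contribute [<grad f (x (t + 1)), w t - x (t + 1)> / A t], and the rest is the
    objective that defines the auxiliary point. *)
Lemma phi_lb :
  (forall t z, 0 <= (Aseq alpha t.+1)^-1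
        * dotv (grad f (x t.+2)) (w t.+1 - x t.+2)
      + xbar_obj f beta lambda alpha mubar x y t.+1 z) ->
  forall t, (Aseq alpha t)^-1 * f (x t.+1) <= phi t.+1 (y t.+1).
Proof.
move=> step; elim=> [|t IH].
  have b0 := ltW (aincr_beta_gt0 hrun); have m0 := aincr_mubar_ge0 hrun 0.
  rewrite Aseq0 invr1 mul1r (aincr_phi1 hrun) -addrA lerDl.
  by rewrite addr_ge0// mulr_ge0 ?divr_ge0 ?exprn_ge0 ?enorm_ge0.
have := step t (y t.+2); move: (y t.+2) => z; rewrite /xbar_obj /lambdabar/=.
have := unif_convex_argmin _ _ _ _ z (phi_unif_convex t) (aincr_y hrun (ltn0Sn t)).
have conv := strongly_convex_grad _ _ hC2 hlip _ (x t.+2) (x t.+1)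
  (aincr_lambda_param hrun).
have i0 : 0 <= (Aseq alpha t)^-1 by rewrite invr_ge0 ltW ?Aseq_gt0.
have := ler_wpM2l i0 conv.
have lam0 := aincr_lambda_ge0 hrun.
have lam1 (e : R) : 0 <= lambda * e ^+ 2 by rewrite mulr_ge0 ?sqr_ge0.
have := mulr_ge0 i0 (lam1 (enorm (x t.+1 - x t.+2))).
have := mulr_ge0 (weight_ge0 t) (lam1 (enorm (z - x t.+2))).
have i1 : 0 <= (Aseq alpha t)^-1 - 1 by rewrite subr_ge0 Aseq_inv_ge1.
have := mulr_ge0 i1 (lam1 (enorm (z - y t.+1))).
have dm : 0 <= mubar t.+1 - mubar t by rewrite subr_ge0 (aincr_mubar_nondecr hrun).
have := mulr_ge0 dm (sqr_ge0 (enorm (z - x0))).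
have wE : (Aseq alpha t.+1)^-1 * dotv (grad f (x t.+2)) (w t.+1 - x t.+2)
    = (Aseq alpha t)^-1 * dotv (grad f (x t.+2)) (x t.+1 - x t.+2)
      + alpha t.+1 / Aseq alpha t.+1 * dotv (grad f (x t.+2)) (y t.+1 - x t.+2).
  by rewrite (aincr_w hrun)// (Aseq_inv t) !dotvE; ring.
rewrite (aincr_phiS hrun (ltn0Sn t) z)/= wE; have := weight_inv t.
move: (alpha t.+1 / _) => a ->.
have zE : dotv (grad f (x t.+2)) (z - x t.+2) =
    dotv (grad f (x t.+2)) (z - y t.+1) + dotv (grad f (x t.+2)) (y t.+1 - x t.+2).
  by rewrite -dotvDr addrA subrK.
rewrite zE; vlra.
Qed.

Lemma gap_bound z :
  (forall t z, 0 <= (Aseq alpha t.+1)^-1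
        * dotv (grad f (x t.+2)) (w t.+1 - x t.+2)
      + xbar_obj f beta lambda alpha mubar x y t.+1 z) ->
  forall t, f (x t.+1) - f z <= Aseq alpha t *
    ((mu 0 + mubar t) / 2 * enorm (x0 - z) ^+ 2
     + (2 * gamma + beta) / 6 * enorm (x0 - z) ^+ 3).
Proof.
move=> /phi_lb lb t.
have zx : enorm (x0 - z) = enorm (z - x0) by rewrite -enormN opprB.
rewrite mulrC -ler_pdivrMr ?Aseq_gt0// zx.
have := lb t; have := aincr_y hrun (ltn0Sn t) z; have := phi_ub t z.
have := first_step_gap z; vlra.
Qed.

(** At a point at distance [rho] of [y t], the progress of the step from [w t],
    applied with [v = alpha t * rho], outweighs the linear term of the
    objective. *)
Lemma step_condition t z :
  eta = 4 * gamma ->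
  let rho := enorm (z - y t.+1) in
  3 / 8 * mu t.+1 * alpha t.+1 ^+ 2 * rho ^+ 2
    + gamma / 2 * alpha t.+1 ^+ 3 * rho ^+ 3
  <= Aseq alpha t.+1 * ((mubar t + lambdabar lambda alpha t.+1) / 2 * rho ^+ 2
      + beta / 12 * rho ^+ 3) ->
  0 <= (Aseq alpha t.+1)^-1 * dotv (grad f (x t.+2)) (w t.+1 - x t.+2)
     + xbar_obj f beta lambda alpha mubar x y t.+1 z.
Proof.
move=> eta4 rho cond.
have A0 := Aseq_gt0 t.+1.
have /andP[a0 _] := aincr_alpha_itv hrun (ltn0Sn t).
have ar0 : 0 <= alpha t.+1 * rho by rewrite mulr_ge0 ?enorm_ge0// ltW.
have xmin := aincr_xS hrun (ltn0Sn t); rewrite eta4 in xmin.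
have [Elb Eub] := hH t.+1.
have := cubic_step_progress _ _ _ _ _ _ _ hC2 hlip hgamma (hmu t.+1)
  (aincr_H_sym hrun t.+1) Elb Eub xmin ar0.
have := ler_wpM2l (ltW a0) (cauchy_schwarz_opp (grad f (x t.+2)) (z - y t.+1)).
rewrite -(pmulr_rge0 _ A0) /xbar_obj /= mulrDr mulVKf ?gt_eqF//.
rewrite mulrDr [X in _ + (_ + X)]mulrA [Aseq _ _ * (_ / _)]mulrC divfK ?gt_eqF//.
rewrite -/rho in cond *.
vlra.
Qed.

End EstimateSequence.

Arguments Aseq_gt0 {R n f gamma eta beta lambda alpha mubar x0 H w x y phi}.
Arguments gap_bound {R n f gamma eta beta lambda alpha mubar mu x0 H w x y phi}.
Arguments step_condition
  {R n f gamma eta beta lambda alpha mubar mu x0 H w x y phi}.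

(** * The two parameter regimes *)

Section Regimes.
Context {R : realType}.

Lemma powR_inv_natK (k : nat) (a : R) : (0 < k)%N -> 0 <= a ->
  (a `^ (k%:R^-1)) ^+ k = a.
Proof.
move=> k0 a0; rewrite -powR_mulrn ?powR_ge0// -powRrM mulVf ?powRr1//.
by rewrite pnatr_eq0 -lt0n.
Qed.

Lemma le_root_ratio (k : nat) (c a b : R) : (0 < k)%N ->
  0 <= c -> 0 <= a -> 0 <= b -> (c%:E <= root_ratio k a b)%E -> b * c ^+ k <= a.
Proof.
move=> k0 c0 a0 b0; rewrite /root_ratio.
have [->|bn0] := eqVneq b 0; first by rewrite mul0r.
rewrite lee_fin => cab.
have b_gt0 : 0 < b by rewrite lt_def bn0.
rewrite mulrC -ler_pdivlMr//.
rewrite -[leRHS](powR_inv_natK k)//; last by rewrite divr_ge0.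
by rewrite lerXn2r ?nnegrE ?powR_ge0.
Qed.

Lemma root_ratio_ge0 (k : nat) (a b : R) : (0 <= root_ratio k a b)%E.
Proof. by rewrite /root_ratio; case: ifP => // _; rewrite lee_fin powR_ge0. Qed.

(** The constant [18 sqrt 3 >= 27] of the second term leaves exactly what
    [strongly_convex_step_scalar] needs when [1 - a] is bounded below by [1/9]. *)
Lemma alpha_hat_bounds (lambda gamma mu_u Rbar a : R) :
  a = alpha_hat lambda gamma mu_u Rbar ->
  0 < lambda -> 0 < gamma -> 0 <= mu_u -> 0 < Rbar ->
  [/\ a <= 8 / 9, 27 * mu_u * a ^+ 2 <= lambda
    & 64 * a ^+ 3 * gamma * Rbar <= lambda].
Proof.
rewrite /alpha_hat; set m := mine _ _ => a_def l0 g0 m0 R0.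
have gR0 : 0 < gamma * Rbar by rewrite mulr_gt0.
have m_ge0 : (0 <= m)%E.
  rewrite /m !le_min root_ratio_ge0 mule_ge0 ?root_ratio_ge0 ?lee_fin ?invr_ge0//.
  by rewrite divr_ge0.
have m_le : (m <= (8 / 9)%:E)%E by rewrite /m ge_min lexx.
have aE : a%:E = m.
  by rewrite a_def fineK// ge0_fin_numE// (le_lt_trans m_le) ?ltry.
have a0 : 0 <= a by rewrite -lee_fin aE.
split.
- by rewrite -lee_fin aE.
- have h : (a%:E <= root_ratio 2 lambda (18 * Num.sqrt 3 * mu_u))%E.
    by rewrite aE /m !ge_min lexx orbT.
  have s3 : 3 / 2 <= Num.sqrt 3 :> R.
    rewrite -(ler_pXn2r (ltn0Sn 1)) ?nnegrE ?sqrtr_ge0 ?divr_ge0//.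
    by rewrite sqr_sqrtr//; lra.
  have := le_root_ratio 2 _ _ _ isT a0 (ltW l0) _ h.
  rewrite !mulr_ge0 ?sqrtr_ge0// => /(_ isT).
  apply: le_trans; rewrite !ler_wpM2r ?sqr_ge0//; lra.
- have h : (a%:E <= (4^-1)%:E * root_ratio 3 lambda (gamma * Rbar))%E.
    by rewrite aE /m !ge_min lexx !orbT.
  have h4 : ((4 * a)%:E <= root_ratio 3 lambda (gamma * Rbar))%E.
    move: h; rewrite /root_ratio gt_eqF// -EFinM !lee_fin; lra.
  have := le_root_ratio 3 _ _ _ isT (mulr_ge0 (ler0n R 4) a0) (ltW l0) (ltW gR0) h4.
  by rewrite exprMn; lra.
Qed.

(** With [a] for [A (t - 1)] and [al] for [alpha t], the right-hand side equals
    [(1 - al) lambda / 8 * ((2 - a) rho^2 + a rho^3 / Rbar)]. The cubic term decays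
    with [a], but since [rho^3 / Rbar <= rho^2] the surplus [1 - a] of the
    quadratic term makes up for it, and [rho^2 + rho^3 / Rbar] remains. *)
Lemma strongly_convex_step_scalar (lambda gamma beta mu mu_u Rbar a al rho : R) :
  0 < lambda -> 0 < gamma -> 0 <= mu <= mu_u -> 0 < Rbar ->
  0 < a -> a <= 1 -> 0 < al -> 0 <= rho -> rho <= Rbar ->
  al <= 8 / 9 -> 27 * mu_u * al ^+ 2 <= lambda ->
  64 * al ^+ 3 * gamma * Rbar <= lambda ->
  beta = 3 * lambda / (2 * Rbar) ->
  3 / 8 * mu * al ^+ 2 * rho ^+ 2 + gamma / 2 * al ^+ 3 * rho ^+ 3 <=
  (a * (1 - al)) * ((lambda / 4 + lambda / 2 * (a^-1 - 1)) / 2 * rho ^+ 2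
    + beta / 12 * rho ^+ 3).
Proof.
move=> l0 g0 /andP[mu0 muu] R0 a0 a1 al0 rho0 rhoR al89 al2 al3 ->.
pose k := Rbar^-1.
have k0 : 0 < k by rewrite invr_gt0.
have rk1 : rho * k <= 1 by rewrite ler_pdivrMr ?mul1r.
have -> : (a * (1 - al)) * ((lambda / 4 + lambda / 2 * (a^-1 - 1)) / 2 * rho ^+ 2
    + 3 * lambda / (2 * Rbar) / 12 * rho ^+ 3)
  = (1 - al) * (lambda / 8) * (rho ^+ 2 + rho ^+ 3 * k
      + (1 - a) * (rho ^+ 2 * (1 - rho * k))).
  by rewrite /k; field; rewrite !gt_eqF.
have r2 := sqr_ge0 rho; have r3 : 0 <= rho ^+ 3 by rewrite exprn_ge0.
have r3k : 0 <= rho ^+ 3 * k by rewrite mulr_ge0// ltW.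
have rest : 0 <= (1 - a) * (rho ^+ 2 * (1 - rho * k)).
  by rewrite !mulr_ge0 ?subr_ge0.
have sum0 : 0 <= rho ^+ 2 + rho ^+ 3 * k by rewrite addr_ge0.
apply: (@le_trans _ _ (1 / 9 * (lambda / 8) * (rho ^+ 2 + rho ^+ 3 * k))).
  have al2' : 27 * mu * al ^+ 2 <= lambda.
    by apply: le_trans al2; rewrite ler_wpM2r ?sqr_ge0// ler_wpM2l.
  have := ler_wpM2r r2 al2'; have := ler_wpM2r r3k al3.
  have kR : k * Rbar = 1 by rewrite mulVf ?gt_eqF.
  have -> : 64 * al ^+ 3 * gamma * Rbar * (rho ^+ 3 * k)
      = 64 * al ^+ 3 * gamma * rho ^+ 3 * (k * Rbar) by ring.
  rewrite kR.
  have : 0 <= al ^+ 3 * gamma * rho ^+ 3 by rewrite !mulr_ge0 ?exprn_ge0// ltW.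
  lra.
apply: ler_pM => //; last by lra.
  by rewrite mulr_ge0// divr_ge0// ltW.
by apply: ler_wpM2r; lra.
Qed.

(** Here [3 / (t + 4)] is [alpha (t + 1)] and [6 / ((t + 2) (t + 3) (t + 4))] is
    [A (t + 1)]: after cancellation both coefficients are compared through
    [1 / (t + 4) <= 1 / (t + 3) <= 1 / (t + 2)]. *)
Lemma convex_step_scalar (t : nat) (gamma mu mu_u rho : R) :
  0 < gamma -> 0 <= mu <= mu_u -> 0 <= rho ->
  3 / 8 * mu * (3 / (t.+1%:R + 3)) ^+ 2 * rho ^+ 2
    + gamma / 2 * (3 / (t.+1%:R + 3)) ^+ 3 * rho ^+ 3 <=
  6 / ((t%:R + 2) * (t%:R + 3) * (t%:R + 4))
    * (2 * mu_u * (t%:R + 2) / 2 * rho ^+ 2 + 96 * gamma / 12 * rho ^+ 3).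
Proof.
move=> g0 /andP[mu0 muu] rho0.
have t0 : 0 <= t%:R :> R by [].
have -> : t.+1%:R + 3 = t%:R + 4 :> R by rewrite -natr1; ring.
move: (t%:R : R) t0 => {}t t0.
pose p2 := (t + 2)^-1; pose p3 := (t + 3)^-1; pose p4 := (t + 4)^-1.
have p4_gt0 : 0 < p4 by rewrite invr_gt0; lra.
have p43 : p4 <= p3 by rewrite lef_pV2 ?posrE; lra.
have p32 : p3 <= p2 by rewrite lef_pV2 ?posrE; lra.
have -> : 3 / (t + 4) = 3 * p4 by [].
have -> : 6 / ((t + 2) * (t + 3) * (t + 4))
    * (2 * mu_u * (t + 2) / 2 * rho ^+ 2 + 96 * gamma / 12 * rho ^+ 3)
  = 6 * (mu_u * (p3 * p4)) * rho ^+ 2 + 48 * (gamma * (p2 * p3 * p4)) * rho ^+ 3.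
  by rewrite /p2 /p3 /p4; field; rewrite !gt_eqF//; lra.
have p40 := ltW p4_gt0; have g0' := ltW g0.
have h2 : mu * (p4 * p4) * rho ^+ 2 <= mu_u * (p3 * p4) * rho ^+ 2.
  apply: ler_wpM2r; first exact: sqr_ge0.
  apply: ler_pM => //; first by rewrite mulr_ge0.
  exact: ler_wpM2r.
have h3 : gamma * (p4 * p4 * p4) * rho ^+ 3 <= gamma * (p2 * p3 * p4) * rho ^+ 3.
  have p42 := le_trans p43 p32.
  apply: ler_wpM2r; first by rewrite exprn_ge0.
  apply: ler_wpM2l => //.
  by apply: ler_wpM2r => //; apply: ler_pM.
have : 0 <= mu * (p4 * p4) * rho ^+ 2.
  by rewrite !mulr_ge0 ?sqr_ge0.
have : 0 <= gamma * (p4 * p4 * p4) * rho ^+ 3.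
  by rewrite !mulr_ge0 ?exprn_ge0.
lra.
Qed.

Context {n : nat}.
Implicit Types (xs z d : 'cV[R]_n).

Lemma grad_argmin (f : 'cV[R]_n -> R) gamma xs : twice_cont_diff f ->
  hess_lipschitz gamma f -> is_argmin f xs -> grad f xs = 0.
Proof.
move=> hC2 hlip xmin.
apply: (argmin_slope0 _ _ _ (specnorm (hess f xs) / 2) (gamma / 6) xmin) => d.
have := taylor_ub _ _ hC2 hlip xs d.
have := cauchy_schwarz (hess f xs *m d) d.
have := ler_wpM2r (enorm_ge0 d) (specnorm_ub (hess f xs) d).
vlra.
Qed.

Lemma quadratic_growth (f : 'cV[R]_n -> R) gamma lambda xs z :
  twice_cont_diff f -> hess_lipschitz gamma f -> strongly_convex lambda f ->
  is_argmin f xs -> lambda / 2 * enorm (z - xs) ^+ 2 <= f z - f xs.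
Proof.
move=> hC2 hlip fsc xmin.
have := strongly_convex_grad _ _ hC2 hlip _ xs z fsc.
rewrite (grad_argmin _ _ _ hC2 hlip xmin) dotv0l; vlra.
Qed.

End Regimes.

Theorem theorem11 (R : realType) (n : nat) (f : 'cV[R]_n -> R)
    (gamma eta beta lambda mu_u : R) (alpha mubar mu : nat -> R)
    (x0 xs : 'cV[R]_n) (H : nat -> 'M[R]_n) (w x y : nat -> 'cV[R]_n)
    (phi : nat -> 'cV[R]_n -> R)
    (hgamma : 0 < gamma)
    (hC2 : twice_cont_diff f)
    (hconv : @convex_function R 'cV[R]_n setT f)
    (hlip : hess_lipschitz gamma f)
    (hxs : is_argmin f xs)
    (hrun : AINCR f gamma eta beta lambda alpha mubar x0 H w x y phi)
    (hmu_u : 0 <= mu_u)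
    (hmu : forall t, 0 <= mu t <= mu_u)
    (hH : forall t,
        loewner_le (mu t / 2)%:M (H t - hess f (w t)) /\
        loewner_le (H t - hess f (w t)) (mu t)%:M) :
  (forall (Rbar : R) (Rt : nat -> R) (xbar : nat -> 'cV[R]_n),
      0 < lambda ->
      strongly_convex lambda f ->
      0 < Rbar ->
      (forall t, (1 <= t)%N ->
         is_argmin (xbar_obj f beta lambda alpha mubar x y t) (xbar t)) ->
      (forall t, (1 <= t)%N -> enorm (xbar t - y t) <= Rt t) ->
      (forall t, (1 <= t)%N -> Rt t <= Rbar) ->
      (forall t, (1 <= t)%N -> alpha t = alpha_hat lambda gamma mu_u Rbar) ->
      (forall t, mubar t = lambda / 4) ->
      beta = 3 * lambda / (2 * Rbar) ->
      eta = 4 * gamma ->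
      forall t, (1 <= t)%N ->
        f (x t) - f xs <=
          2 * (1 - alpha_hat lambda gamma mu_u Rbar) ^+ t.-1
            * (f x0 - f xs)
            * ((2 * mu_u * lambda^-1 + 1) / 4
               + (4 * gamma * lambda^-1 + 3 * Rbar^-1) / 12
                 * enorm (x0 - xs)))
  /\
  (lambda = 0 ->
   (forall t, alpha t = 3 / (t%:R + 3)) ->
   (forall t, mubar t = 2 * mu_u * (t%:R + 2)) ->
   beta = 96 * gamma ->
   eta = 4 * gamma ->
   forall t, (1 <= t)%N ->
     f (x t) - f xs <=
       98 * gamma * enorm (x0 - xs) ^+ 3
         / (t%:R * (t%:R + 1) * (t%:R + 2))
       + 12 * mu_u * enorm (x0 - xs) ^+ 2 / (t%:R * (t%:R + 2))).
Proof.
have hmu0 t : 0 <= mu t by have /andP[] := hmu t.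
have gap z := gap_bound hgamma hC2 hlip hrun hmu0 hH z.
have cond t z := step_condition hgamma hC2 hlip hrun hmu0 hH t z.
have A0 := Aseq_gt0 hrun.
split.
- move=> Rbar Rt xbar l0 fsc R0 xbar_min xbarRt RtR alphaE mubarE betaE etaE.
  have a1 := alphaE 1%N isT.
  have /andP[al_gt0 al_lt1] := aincr_alpha_itv hrun (ltn0Sn 0).
  have [al89 al2 al3] := alpha_hat_bounds _ _ _ _ _ a1 l0 hgamma hmu_u R0.
  have {}alphaE t : (1 <= t)%N -> alpha t = alpha 1%N by move=> /alphaE->.
  rewrite -a1; move: (alpha 1%N) alphaE al_gt0 al_lt1 al89 al2 al3 => al
    alphaE al_gt0 al_lt1 al89 al2 al3 {a1}.
  have AE t : Aseq alpha t = (1 - al) ^+ t.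
    elim: t => [|t IH]; first by rewrite Aseq0 expr0.
    by rewrite AseqS IH alphaE// exprSr.
  have step t z : 0 <= (Aseq alpha t.+1)^-1
        * dotv (grad f (x t.+2)) (w t.+1 - x t.+2)
      + xbar_obj f beta lambda alpha mubar x y t.+1 z.
    (* It suffices to check the minimizer of the auxiliary objective, the only
       point known to be within Rbar of y (t + 1). *)
    apply: le_trans (_ : _ <= (Aseq alpha t.+1)^-1
        * dotv (grad f (x t.+2)) (w t.+1 - x t.+2)
      + xbar_obj f beta lambda alpha mubar x y t.+1 (xbar t.+1)) _; last first.
      by rewrite lerD2l; exact: xbar_min.
    apply: cond => //; rewrite AseqS alphaE// mubarE /lambdabar /=.
    apply: (strongly_convex_step_scalar _ _ _ _ mu_u Rbar) => //.
    + by rewrite AE exprn_ile1//; lra.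
    + exact: enorm_ge0.
    + exact: le_trans (xbarRt t.+1 isT) (RtR t.+1 isT).
  case=> // t _ /=; apply: le_trans (gap xs step t) _.
  rewrite AE !mubarE betaE.
  have growth := quadratic_growth _ _ _ _ x0 hC2 hlip fsc hxs.
  have P0 : 0 <= (1 - al) ^+ t by rewrite exprn_ge0// subr_ge0 ltW.
  rewrite -!(mulrA 2) [leRHS]mulrCA -(mulrA (_ ^+ t)); apply: ler_wpM2l => //.
  have := enorm_ge0 (x0 - xs); move: (enorm (x0 - xs)) growth => d growth d0.
  move: (f x0 - f xs) growth => F growth.
  have /andP[_ muu] := hmu 0%N; have l0' := ltW l0.
  have d2 : d ^+ 2 <= 2 * F / lambda by rewrite ler_pdivlMr//; lra.
  have F0 : 0 <= F by apply: le_trans growth; rewrite mulr_ge0 ?sqr_ge0// divr_ge0.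
  apply: (@le_trans _ _ ((mu_u + lambda / 4) / 2 * (2 * F / lambda)
      + (2 * gamma + 3 * lambda / (2 * Rbar)) / 6 * (d * (2 * F / lambda)))).
    have b0 : 0 <= 3 * lambda / (2 * Rbar) by rewrite divr_ge0 ?mulr_ge0 ?ltW.
    rewrite (exprS d 2); apply: lerD.
      by apply: ler_pM; rewrite ?sqr_ge0//; have := hmu0 0%N; lra.
    apply: ler_wpM2l; first lra.
    exact: ler_wpM2l.
  (* The two sides differ because mubar / 2 is lambda / 8, half of what the
     announced constant allows. *)
  rewrite -subr_ge0.
  by rewrite (_ : _ - _ = F / 4) ?divr_ge0//; field; rewrite !gt_eqF.
- move=> lambda0 alphaE mubarE betaE etaE.
  have AE t : Aseq alpha t = 6 / ((t%:R + 1) * (t%:R + 2) * (t%:R + 3)).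
    elim: t => [|t IH]; first by rewrite Aseq0 !add0r mul1r -natrM mulfV ?pnatr_eq0.
    rewrite AseqS IH alphaE -[t.+1%:R]natr1; have : 0 <= t%:R :> R by [].
    by move: (t%:R : R) => T T0; field; rewrite !gt_eqF//; lra.
  have step t z : 0 <= (Aseq alpha t.+1)^-1
        * dotv (grad f (x t.+2)) (w t.+1 - x t.+2)
      + xbar_obj f beta lambda alpha mubar x y t.+1 z.
    apply: cond => //; rewrite alphaE mubarE betaE /lambdabar lambda0 !mul0r addr0.
    have -> : Aseq alpha t.+1 = 6 / ((t%:R + 2) * (t%:R + 3) * (t%:R + 4)).
      rewrite AE -[t.+1%:R]natr1 -!addrA.
      by congr (6 / ((_ + _) * (_ + _) * (_ + _))); ring.
    by apply: convex_step_scalar => //; exact: enorm_ge0.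
  case=> // t _; apply: le_trans (gap xs step t) _.
  rewrite AE !mubarE betaE -[t.+1%:R]natr1.
  have : 0 <= t%:R :> R by [].
  have := enorm_ge0 (x0 - xs); move: (enorm (x0 - xs)) => d d0.
  have /andP[_ muu] := hmu 0%N.
  move: (t%:R : R) => T T0.
  have -> : 98 * gamma * d ^+ 3 / ((T + 1) * (T + 1 + 1) * (T + 1 + 2))
      + 12 * mu_u * d ^+ 2 / ((T + 1) * (T + 1 + 2))
    = 6 / ((T + 1) * (T + 2) * (T + 3))
      * (2 * mu_u * (T + 2) * d ^+ 2 + (2 * gamma + 96 * gamma) / 6 * d ^+ 3).
    by field; rewrite !gt_eqF//; lra.
  apply: ler_wpM2l; first by rewrite divr_ge0 ?mulr_ge0//; lra.
  rewrite lerD2r; apply: ler_wpM2r; first exact: sqr_ge0.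
  have : 0 <= mu_u * T by rewrite mulr_ge0.
  lra.
Qed.
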